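(* Let $\mathcal{D}$ be any distribution over $\mathbb{R}_{\geq 0}^k$ with $0<\mathrm{BRev}(\mathcal{D})<\infty$. Then there exists a sequence $X=(\vec{x}_i)_{i=1}^N$ ($N$ finite or $N=+\infty$) with every $\vec{x}_i\in\mathrm{supp}(\mathcal{D})$ and $\vec x_i\neq \vec 0$, such that \[\mathrm{MenuGap}(X)\geq \frac{\mathrm{Rev}(\mathcal{D})}{9\,\mathrm{BRev}(\mathcal{D})}.\] In particular, if $\mathrm{Rev}(\mathcal{D})/\mathrm{BRev}(\mathcal{D})=\infty$, then $\mathrm{MenuGap}(X)=\infty$.
   Context: Setting: one seller, one additive buyer, $k$ items; the buyer's value vector $\vec v\in\mathbb{R}^k_{\ge0}$ is drawn from a (possibly correlated) distribution $\mathcal{D}$. A mechanism $M$ is a set of options $(\vec q,p)$ with $\vec q\in[0,1]^k$, $p\in\mathbb{R}$, always containing the null option $(\vec 0,0)$; a buyer with values $\vec v$ selects an option maximizing $\vec v\cdot\vec q-p$ (ties broken arbitrarily; a maximizer is assumed to exist), and $\vec q^M(\vec v),p^M(\vec v)$ denote the allocation and price of the selected option. $\mathrm{Rev}(\mathcal{D},M)=\mathbb{E}_{\vec v\sim\mathcal{D}}[p^M(\vec v)]$, $\mathrm{Rev}(\mathcal{D})=\sup_M \mathrm{Rev}(\mathcal{D},M)$ (possibly $\infty$), and $\mathrm{BRev}(\mathcal{D})=\sup_{p\ge0} p\cdot\Pr_{\vec v\sim\mathcal{D}}[\sum_i v_i\ge p]$ (revenue of optimally pricing the grand bundle). MenuGap: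 Let $X=(\vec x_i)_{i=1}^N$ be an ordered sequence of nonzero points of $\mathbb{R}^k_{\ge0}$ ($N$ finite or $+\infty$), and $Q=(\vec q_i)_{i=0}^N$ an ordered sequence of points of $[0,1]^k$ with $\vec q_0=(0,\dots,0)$. Define $\mathrm{gap}_i^{X,Q}:=\min_{0\le j<i}(\vec q_i-\vec q_j)\cdot\vec x_i$ and $\mathrm{MenuGap}(X,Q):=\sum_{i=1}^N \mathrm{gap}_i^{X,Q}/\|\vec x_i\|_1$, and $\mathrm{MenuGap}(X):=\sup_Q \mathrm{MenuGap}(X,Q)$. *)

(* Defs.v *)
From HB Require Import structures.
From mathcomp Require Import all_boot all_order all_algebra.
From mathcomp Require Import all_classical all_reals all_analysis.
Set Implicit Arguments. Unset Strict Implicit. Unset Printing Implicit Defensive.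
Import Order.TTheory GRing.Theory Num.Theory.
Import numFieldNormedType.Exports.
Local Open Scope classical_set_scope.
Local Open Scope ring_scope.

Section Defs.
Variables (R : realType) (k : nat).

(* vectors of R^k are k-tuples; the measurable structure on k.-tuple R is the
   product (= Borel) sigma-algebra of MathComp-Analysis *)
Definition vec := k.-tuple R.
Definition dot (u v : vec) : R := \sum_(l < k) tnth u l * tnth v l.
Definition norm1 (x : vec) : R := \sum_(l < k) `|tnth x l|.
Definition vsum (x : vec) : R := \sum_(l < k) tnth x l.
Definition nonneg_vec (x : vec) : Prop := forall l, 0 <= tnth x l.
Definition zero_vec (x : vec) : Prop := forall l, tnth x l = 0.

Definition option_ := (vec * R)%type.
Definition utility (v : vec) (o : option_) : R := dot v o.1 - o.2.

Definition is_mechanism (M : set option_) : Prop :=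
  (forall o, M o -> forall l, 0 <= tnth o.1 l <= 1) /\
  (exists o, M o /\ zero_vec o.1 /\ o.2 = 0).

Definition valid_selection (M : set option_) (sel : vec -> option_) : Prop :=
  forall v, nonneg_vec v ->
    M (sel v) /\ forall o, M o -> utility v o <= utility v (sel v).

Variable D : probability (k.-tuple R) R.

Definition Rev : \bar R :=
  ereal_sup [set r | exists (M : set option_) (sel : vec -> option_),
    [/\ is_mechanism M, valid_selection M sel,
        measurable_fun setT (fun v : k.-tuple R => (sel v).2) &
        r = (\int[D]_v ((sel v).2)%:E)%E]].

Definition BRev : \bar R :=
  ereal_sup [set (p%:E * D [set v : k.-tuple R | (p <= vsum v)%R])%E |
             p in [set p : R | 0 <= p]].

Definition in_supp (x : vec) : Prop :=
  forall e : R, 0 < e ->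
    (0 < D [set y : k.-tuple R | forall l, (`|tnth y l - tnth x l| < e)%R])%E.

End Defs.

Inductive seqlen := Fin of nat | Inf.
Definition in_range (N : seqlen) (i : nat) : bool :=
  (0 < i)%N && (if N is Fin n then (i <= n)%N else true).

Section MenuGap.
Variables (R : realType) (k : nat).

Definition gap (X Q : nat -> vec R k) (i : nat) : R :=
  \big[Order.min/ \sum_(l < k) (tnth (Q i) l - tnth (Q 0%N) l) * tnth (X i) l]_(j < i)
    \sum_(l < k) (tnth (Q i) l - tnth (Q j) l) * tnth (X i) l.

Definition menugap_partial (N : seqlen) (X Q : nat -> vec R k) (n : nat) : R :=
  \sum_(1 <= i < n.+1 | in_range N i) gap X Q i / norm1 (X i).

Definition valid_Q (Q : nat -> vec R k) : Prop :=
  zero_vec (Q 0%N) /\ forall i l, 0 <= tnth (Q i) l <= 1.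

(* MenuGap(X,Q) is the (extended-real) value of the series; MenuGap(X) is the
   sup over all Q for which this series has a value (always the case for
   finite N) *)
Definition MenuGap (N : seqlen) (X : nat -> vec R k) : \bar R :=
  ereal_sup [set l : \bar R | exists Q, valid_Q Q /\
     ((fun n => (menugap_partial N X Q n)%:E) @ \oo --> l)].

End MenuGap.

(* Main.v *)
Require Import Defs.
From HB Require Import structures.
From mathcomp Require Import all_boot all_order all_algebra.
From mathcomp Require Import all_classical all_reals all_analysis.
From mathcomp Require Import measurable_realfun lra.
Set Implicit Arguments. Unset Strict Implicit. Unset Printing Implicit Defensive.
Import Order.TTheory GRing.Theory Num.Theory.
Local Open Scope classical_set_scope.
Local Open Scope ring_scope.

(** Fix a mechanism with price function [p] and a small [e > 0], and let [S n]
    be the event [e 2^n <= p < e 2^(n+1)]. Up to [e], the revenue is at most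
    [sum_n e 2^(n+1) D(S n)]. Since bundling at price [a] earns at most [BRev],
    each [S n] of positive measure contains a support point [x_n] with
    [D(S n) <= 9/8 BRev / |x_n|]. Restrict to the levels [n] of the better
    parity and let [q_n] be the allocation that [x_n] selects: by incentive
    compatibility the gap at [x_n] is at least
    [p(x_n) - p(x_n') >= e 2^n - e 2^(n-1)], where [n' <= n - 2]. This turns any
    [c < Rev / (9 BRev)] into a finite sequence of support points whose gap sum
    is at least [c].

    The supremum of the [c]'s, possibly infinite, is reached by a single
    sequence: concatenate the finite sequences for all rational [c]. To exploit
    one block, allocate nothing before it and everything after it. *)

(** * Gap sums of finite sequences and of their concatenation *)

Section GapSums.
Context {R : realType} {k : nat}.
Implicit Types (x : vec R k) (X Q : nat -> vec R k) (s : seq (vec R k)).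

(** The default value of the minimum is its term for [j = 0], which is already among the terms when
    [i > 0]. *)
Lemma gap_geP X Q (g : R) (i : nat) : (0 < i)%N ->
  (forall j, (j < i)%N ->
    g <= \sum_(l < k) (tnth (Q i) l - tnth (Q j) l) * tnth (X i) l) <->
  g <= gap X Q i.
Proof.
move=> i0; split=> [h|/bigmin_geP[_ h] j ji].
  by apply/bigmin_geP; split=> [|j _]; apply: h.
exact: (h (Ordinal ji)).
Qed.

Lemma norm1_ge0 x : 0 <= norm1 x.
Proof. exact: sumr_ge0. Qed.

Let zvec : vec R k := [tuple 0 | _ < k].
Let onevec : vec R k := [tuple 1 | _ < k].

(** Points are numbered from 1, as in [MenuGap]. *)
Definition seq_points s (i : nat) : vec R k := nth zvec s i.-1.

(** Gaps are required to be nonnegative so that partial sums stay monotone once the sequence is a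
    block of an infinite one. *)
Definition gap_sum_ge s (c : R) : Prop := exists Q, [/\ valid_Q Q,
  forall i, (0 < i <= size s)%N -> 0 <= gap (seq_points s) Q i &
  c <= \sum_(1 <= i < (size s).+1)
         gap (seq_points s) Q i / norm1 (seq_points s i)].

Section Concatenation.
Variable s_ : nat -> seq (vec R k).
Hypothesis s_gt0 : forall m, (0 < size (s_ m))%N.

Let pre m := flatten (mkseq s_ m).

Let preS m : pre m.+1 = pre m ++ s_ m.
Proof. by rewrite /pre mkseqS flatten_rcons. Qed.

Let size_pre_ge m : (m <= size (pre m))%N.
Proof.
elim: m => // m IH; rewrite preS size_cat -addn1.
exact: leq_add.
Qed.

Let nth_pre_add m d i : (i < size (pre m))%N ->
  nth zvec (pre (m + d)) i = nth zvec (pre m) i.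
Proof.
move=> im; elim: d => [|d IH]; first by rewrite addn0.
rewrite addnS preS nth_cat ifT //.
apply: (leq_trans im); elim: d {IH} => [|d IH]; first by rewrite addn0.
by rewrite addnS preS size_cat (leq_trans IH) // leq_addr.
Qed.

(** Nonempty blocks make [pre i], the first [i] blocks, at least [i] points long, so it already
    contains point [i]. *)
Definition concat_points (i : nat) : vec R k := seq_points (pre i) i.

Let concat_pointsE m i : (0 < i <= size (pre m))%N ->
  concat_points i = nth zvec (pre m) i.-1.
Proof.
case: i => // i /= im; rewrite /concat_points /seq_points /=.
have [mi|mi] := leqP m i.+1.
  by rewrite -(subnKC mi) nth_pre_add.
by rewrite -(subnKC (ltnW mi)) nth_pre_add// size_pre_ge.
Qed.

Let concat_points_block m i : (0 < i <= size (s_ m))%N ->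
  concat_points (i + size (pre m)) = seq_points (s_ m) i.
Proof.
case: i => // i /= im; rewrite (@concat_pointsE m.+1).
  rewrite preS nth_cat addSn /= ifF; last by apply/negbTE; rewrite -leqNgt leq_addl.
  by rewrite addnK.
by rewrite addSn /= preS size_cat addnC ltn_add2l.
Qed.

Lemma concat_points_in i : (0 < i)%N -> exists m, concat_points i \in s_ m.
Proof.
case: i => // i _.
have : concat_points i.+1 \in pre i.+1.
  by rewrite (@concat_pointsE i.+1) /= ?mem_nth// size_pre_ge.
by case/flattenP => _ /mapP[m _ ->] h; exists m.
Qed.

Hypothesis s_ge0 : forall m x, x \in s_ m -> nonneg_vec x.

(* Offering nothing before block [m] and everything after it keeps all the
   other gaps nonnegative. *)
Lemma MenuGap_concat m (c : R) : gap_sum_ge (s_ m) c ->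
  (c%:E <= MenuGap Inf concat_points)%E.
Proof.
move=> [Q [[Q0 Q01] gapQ cQ]].
pose a := size (pre m); pose b := size (s_ m).
pose Q' i := if (i <= a)%N then zvec else
  if (i <= b + a)%N then Q (i - a)%N else onevec.
have Q'01 i l : 0 <= tnth (Q' i) l <= 1.
  rewrite /Q'; case: ifP => _; first by rewrite tnth_mktuple lexx ler01.
  by case: ifP => _ //; rewrite tnth_mktuple ler01 lexx.
have gap_block i : (0 < i <= b)%N ->
    gap (seq_points (s_ m)) Q i <= gap concat_points Q' (i + a).
  move=> /andP[i0 ib]; apply/gap_geP; first by rewrite addn_gt0 i0.
  move=> j ji; rewrite concat_points_block ?i0//.
  have -> : Q' (i + a)%N = Q i.
    by rewrite /Q' leqNgt -[X in (X < _)%N]add0n ltn_add2r i0 leq_add2r ib addnK.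
  (* The block's gap is at most each of its own terms; the zero allocations at [j <= a] are matched
     with its term at index 0. *)
  have /(gap_geP _ _ _ i0) : gap (seq_points (s_ m)) Q i <=
    gap (seq_points (s_ m)) Q i by [].
  rewrite /Q'; case: (leqP j a) => ja h.
    apply: le_trans (h 0%N i0) _; rewrite le_eqVlt; apply/orP; left; apply/eqP.
    by apply: eq_bigr => l _; rewrite tnth_mktuple Q0.
  rewrite (leq_trans (ltnW ji)) ?leq_add2r//.
  by apply: h; rewrite ltn_subLR ?(ltnW ja)// addnC.
have gap_ge0 i : (0 < i)%N -> 0 <= gap concat_points Q' i.
  move=> i0; have [ia|ai] := leqP i a.
    apply/gap_geP => // j ji; rewrite /Q' ia (leq_trans (ltnW ji) ia).
    by apply: sumr_ge0 => l _; rewrite subrr mul0r.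
  have [ib|bi] := leqP i (b + a).
    have iab : (0 < i - a <= b)%N by rewrite subn_gt0 ai leq_subLR addnC.
    rewrite -(subnK (ltnW ai)); apply: le_trans (gap_block _ iab).
    exact: gapQ.
  apply/gap_geP => // j ji; apply: sumr_ge0 => l _; apply: mulr_ge0.
    rewrite {1}/Q' leqNgt ai leqNgt bi /= tnth_mktuple subr_ge0.
    by case/andP: (Q'01 j l).
  by have [n /s_ge0] := concat_points_in i0; apply.
have term_ge0 i : (0 < i)%N ->
    0 <= gap concat_points Q' i / norm1 (concat_points i).
  by move=> i0; rewrite divr_ge0 ?norm1_ge0 ?gap_ge0.
pose u n := menugap_partial Inf concat_points Q' n.
(* [MenuGap] only admits a [Q'] whose series has a value; monotone partial sums give one, at least
   the partial sum that ends with block [m]. *)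
have u_nd : {homo (EFin \o u) : n p / (n <= p)%N >-> (n <= p)%E}.
  apply: (homo_leq (r := fun x y : \bar R => (x <= y)%E)) => //.
    by move=> y x z; apply: le_trans.
  move=> n; rewrite /= lee_fin /u /menugap_partial.
  rewrite [leRHS]big_mkcond [leLHS]big_mkcond /=.
  by rewrite [leRHS]big_nat_recr //= lerDl term_ge0.
apply: (@le_trans _ _ (u (b + a)%N)%:E); last first.
  apply: (@le_trans _ _ (ereal_sup (range (EFin \o u)))).
    by apply: ereal_sup_ubound; exists (b + a)%N.
  apply: ereal_sup_ubound; exists Q'; split; last exact: ereal_nondecreasing_cvgn.
  by split => // l; rewrite /Q' tnth_mktuple.
rewrite lee_fin (le_trans cQ)// /u /menugap_partial.
rewrite [leRHS](@big_cat_nat _ _ _ a.+1)//= ?ltnS ?leq_addl//.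
apply: ler_wpDl.
  by apply: sumr_ge0 => i /andP[i0 _]; apply: term_ge0.
rewrite -[a.+1]add1n big_addn -addSn addnK.
rewrite big_nat_cond [leRHS]big_nat_cond.
rewrite [leRHS](eq_bigl (fun i => (0 < i < (size (s_ m)).+1)%N && true)); last first.
  by move=> i; case: i => //= i; rewrite /in_range addSn.
apply: ler_sum => i /andP[/andP[i0 ib] _].
rewrite concat_points_block ?i0//.
by rewrite ler_wpM2r ?invr_ge0 ?norm1_ge0// gap_block// i0.
Qed.

End Concatenation.
End GapSums.

(** * Support points and the bundling revenue *)

Section Support.
Context {R : realType} {k : nat}.
Variable D : probability (k.-tuple R) R.

Lemma measurable_forall_tnth (I : 'I_k -> interval R) :
  measurable [set y : k.-tuple R | forall l, tnth y l \in I l].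
Proof.
rewrite (_ : mkset _ =
    \bigcap_(l in [set: 'I_k]) ((fun y : k.-tuple R => tnth y l) @^-1` [set` I l])).
  apply: fin_bigcap_measurable => [|l _]; first exact: finite_finset.
  rewrite -[X in measurable X]setTI; apply: measurable_tnth => //.
by apply/seteqP; split=> y h l //=; apply: h.
Qed.

Lemma measurable_vsum : measurable_fun setT (fun y : k.-tuple R => vsum y).
Proof. by apply: measurable_sum => l; apply: measurable_tnth. Qed.

Let box (c : k.-tuple R) (e : R) :=
  [set y : k.-tuple R | forall l, `|tnth y l - tnth c l| < e].

Let measurable_box c e : measurable (box c e).
Proof.
rewrite (_ : box c e = [set y : k.-tuple R | forall l, tnth y l \in
  `]tnth c l - e, tnth c l + e[ ]); first exact: measurable_forall_tnth.
by apply/seteqP; split=> y h l; have := h l; rewrite in_itv /= ltr_distl.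
Qed.

(** A point outside the support lies in a null box with rational centre and radius [1/(j+1)], and
    there are countably many such boxes. *)
Lemma negligible_not_supp : D.-negligible [set x | ~ in_supp D x].
Proof.
pose F n := if @unpickle (k.-tuple rat * nat)%type n is Some (r, j) then
  let A := box (map_tuple ratr r) j.+1%:R^-1 in
  if D A == 0%E then A else set0 else set0.
apply: (@negligibleS _ _ _ _ (\bigcup_n F n)); last first.
  apply: negligible_bigcup => n; rewrite /F.
  case: unpickle => [[r j]|]; last exact: negligible_set0.
  case: ifPn => [/eqP D0|_]; last exact: negligible_set0.
  by exists (box (map_tuple ratr r) j.+1%:R^-1); split.
move=> x /=; rewrite /in_supp => /existsNP[e /not_implyP[e0 /negP De]].
have {De} De : D (box x e) = 0%E.
  by apply/eqP; rewrite -measure_le0 leNgt.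
(* Twice this radius is below [e], so a box of this radius whose centre is that close to [x] stays
   inside [box x e]. *)
have [j je] : exists j : nat, j.+1%:R^-1 < e / 2.
  exists (Num.truncn (e / 2)^-1).
  by rewrite -[ltRHS]invrK ltf_pV2 ?posrE ?invr_gt0 ?divr_gt0// truncnS_gt.
have e'0 : 0 < j.+1%:R^-1 :> R by rewrite invr_gt0.
have [e' e'E] : exists e', e' = j.+1%:R^-1 :> R by exists j.+1%:R^-1.
rewrite -e'E in je e'0.
have /= /choice[r rP] : forall l : 'I_k, exists q : rat,
    ratr q \in `]tnth x l - e', tnth x l + e'[.
  by move=> l; apply: rat_in_itvoo; lra.
exists (pickle ([tuple r l | l < k], j)) => //; rewrite /F pickleK -e'E.
set A := box _ _.
have rx l : `|tnth x l - tnth (map_tuple ratr [tuple r l | l < k]) l| < e'.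
  rewrite tnth_map tnth_mktuple; have := rP l; rewrite in_itv /= ltr_distl; lra.
have AB : A `<=` box x e.
  move=> y Ay l; have := Ay l; have := rx l.
  by rewrite !ltr_distl => /andP[? ?] /andP[? ?]; apply/andP; split; lra.
have -> : D A = 0%E.
  by apply/eqP; rewrite -measure_le0 -De le_measure ?inE//; exact: measurable_box.
by rewrite eqxx.
Qed.

Lemma measurable_vsum_ge (a : R) :
  measurable [set v : k.-tuple R | a <= vsum v].
Proof.
rewrite -[X in measurable X]setTI.
rewrite (_ : mkset _ = (fun y : k.-tuple R => vsum y) @^-1` `[a, +oo[%classic).
  exact: measurable_vsum.
by apply/seteqP; split=> v /=; rewrite in_itv /= andbT.
Qed.

Lemma BRev_ge (p : R) : 0 <= p -> (BRev D < +oo)%E -> (0 < BRev D)%E ->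
  p * fine (D [set v : k.-tuple R | p <= vsum v]) <= fine (BRev D).
Proof.
move=> p0 Boo B0.
have DC : D [set v : k.-tuple R | p <= vsum v] \is a fin_num.
  by apply: fin_num_measure; apply: measurable_vsum_ge.
have Bfin : BRev D \is a fin_num by rewrite gt0_fin_numE.
rewrite -lee_fin EFinM !fineK//.
by apply: ereal_sup_ubound; exists p.
Qed.

Hypothesis D_nonneg : D [set v : k.-tuple R | nonneg_vec v] = 1%E.

Lemma negligible_not_nonneg : D.-negligible [set v : k.-tuple R | ~ nonneg_vec v].
Proof.
have mN : measurable [set v : k.-tuple R | nonneg_vec v].
  rewrite (_ : mkset _ = [set y | forall l, tnth y l \in `[0, +oo[]).
    exact: measurable_forall_tnth.
  by apply/seteqP; split=> v h l; have := h l; rewrite in_itv /= andbT.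
exists (~` [set v : k.-tuple R | nonneg_vec v]); split=> //.
  exact: measurableC.
by have := probability_setC D mN; rewrite D_nonneg subee.
Qed.

Lemma norm1_vsum (x : vec R k) : nonneg_vec x -> norm1 x = vsum x.
Proof. by move=> x0; apply: eq_bigr => l _; rewrite ger0_norm. Qed.

(* Otherwise bundling at price [9/8 BRev / D A] would earn more than [BRev]. *)
Lemma exists_low_norm_supp (A : set (k.-tuple R)) :
  (0 < BRev D)%E -> (BRev D < +oo)%E -> measurable A -> (0 < D A)%E ->
  exists x, [/\ A x, in_supp D x, nonneg_vec x &
    norm1 x * fine (D A) <= 9 / 8 * fine (BRev D)].
Proof.
move=> B0 Boo mA A0.
(* [N] is a null set catching all points outside the support or with a negative coordinate. *)
have [N [mN N0 hN]] := negligibleU negligible_not_supp negligible_not_nonneg.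
have DAfin : D A \is a fin_num by exact: fin_num_measure.
set d := fine (D A); have d0 : 0 < d by rewrite fine_gt0// A0 ltey_eq DAfin.
set B := fine (BRev D); have B0' : 0 < B by rewrite fine_gt0// B0.
apply: contrapT => noex.
pose a := 9 / 8 * B / d; have a0 : 0 < a by rewrite divr_gt0// mulr_gt0.
pose C := [set v : k.-tuple R | a <= vsum v].
have mC : measurable C by exact: measurable_vsum_ge.
have AC : A `<=` C `|` N.
  move=> x Ax; have [Nx|Nx] := pselect (N x); [by right|left].
  rewrite /C /= leNgt; apply/negP => xa; apply: noex; exists x.
  have x0 : nonneg_vec x by apply: contrapT => h; apply/Nx/hN; right.
  split=> //; first by apply: contrapT => h; apply/Nx/hN; left.
  by rewrite norm1_vsum// -ler_pdivlMr// ltW.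
have : (D A <= D C)%E.
  rewrite -[leRHS]adde0 -N0; apply: le_trans (measureU2 D mC mN).
  by rewrite le_measure ?inE//; exact: measurableU.
rewrite -(fineK DAfin) -(fineK (fin_num_measure D _ mC)) lee_fin -/d => dC.
have := BRev_ge (ltW a0) Boo B0; rewrite -/C -/B.
have : a * d <= a * fine (D C) by rewrite ler_pM2l.
(* Here [a * d] is [9 / 8 * B], which exceeds [B]: the contradiction comes from the factor being
   above 1. *)
rewrite /a divfK ?gt_eqF//; lra.
Qed.

End Support.

(** * Dyadic decomposition of an expected price *)

Section Dyadic.
Context {d : measure_display} {T : measurableType d} {R : realType}.
Variables (P : probability T R) (p : T -> R) (e : R).
Hypotheses (mp : measurable_fun setT p) (e0 : 0 < e).

Definition dyadic_level (n : nat) : set T :=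
  [set v | e * 2 ^+ n <= p v < e * 2 ^+ n.+1].

Lemma measurable_dyadic_level n : measurable (dyadic_level n).
Proof.
rewrite -[X in measurable X]setTI.
rewrite (_ : dyadic_level n =
    p @^-1` `[e * 2 ^+ n, e * 2 ^+ n.+1[%classic); first exact: mp.
by apply/seteqP; split=> v /=; rewrite /dyadic_level /= in_itv.
Qed.

(** Take the least [N] with [p v < e * 2 ^+ N]; since [e <= p v] it is positive, and its predecessor
    is the level. *)
Lemma dyadic_level_exists v : e <= p v -> exists n, dyadic_level n v.
Proof.
move=> ev.
have [N pN] : exists n : nat, p v < e * 2 ^+ n.
  exists (Num.truncn (p v / e)).+1; rewrite mulrC -ltr_pdivrMr//.
  apply: lt_trans (truncnS_gt _) _.
  by rewrite -natrX ltr_nat ltn_expl.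
pose Pn n := p v < e * 2 ^+ n.
case: (@ex_minnP Pn); first by exists N.
move=> [|m]; rewrite /Pn ?expr0 ?mulr1; first by rewrite ltNge ev.
move=> hm mmin; exists m; rewrite /dyadic_level /= hm andbT leNgt.
by apply/negP => /mmin; rewrite ltnn.
Qed.

(** Pointwise, the constant [e] covers prices below [e] and the upper end of its level covers any
    other price; sum and integral are then exchanged. *)
Lemma integral_le_dyadic :
  (\int[P]_v (p v)%:E <= e%:E +
    \sum_(0 <= n <oo) (e * 2 ^+ n.+1)%:E * P (dyadic_level n))%E.
Proof.
pose f n v := ((e * 2 ^+ n.+1)%:E * (\1_(dyadic_level n) v)%:E)%E.
have e2 n : 0 <= e * 2 ^+ n :> R by rewrite mulr_ge0 ?exprn_ge0// ltW.
have f0 n v : (0 <= f n v)%E by rewrite /f mule_ge0 ?lee_fin.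
have mi n : measurable_fun setT (EFin \o (\1_(dyadic_level n) : T -> R)).
  apply/measurable_EFinP; apply: measurable_indic.
  exact: measurable_dyadic_level.
have mf n : measurable_fun setT (f n).
  by apply: measurable_funeM; apply: mi.
have mS : measurable_fun setT (fun v => \sum_(0 <= n <oo) f n v)%E.
  exact: ge0_emeasurable_sum.
have fint n : (\int[P]_v f n v = (e * 2 ^+ n.+1)%:E * P (dyadic_level n))%E.
  have i0 v : setT v -> (0 <= (EFin \o (\1_(dyadic_level n) : T -> R)) v)%E.
    by move=> _; rewrite /= lee_fin.
  rewrite (ge0_integralZl P measurableT (mi n) i0) ?lee_fin//.
  by rewrite integral_indic ?setIT//; exact: measurable_dyadic_level.
rewrite integralE.
(* Prices may be negative; the negative part is dropped. *)
apply: (@le_trans _ _ (\int[P]_v ((EFin \o p)^\+ v)))%E.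
  by rewrite -[leRHS]sube0 leeB// integral_ge0.
under eq_eseriesr do rewrite -fint.
rewrite -integral_nneseries//.
have {1}-> : (e%:E = \int[P]_v cst e%:E v)%E.
  by rewrite integral_cst// [X in (_ * X)%E](probability_setT P) mule1.
have c0 (v : T) : setT v -> (0 <= cst e%:E v :> \bar R)%E.
  by move=> _; rewrite lee_fin ltW.
have S0 v : setT v -> (0 <= \sum_(0 <= n <oo) f n v)%E.
  by move=> _; apply: nneseries_ge0.
rewrite -ge0_integralD//.
apply: ge0_le_integral => //.
  by apply: measurable_funepos; apply/measurable_EFinP.
  by apply: emeasurable_funD => //; exact: measurable_cst.
move=> v _; rewrite /cst /= funeposE /=.
have [pe|ep] := ltP (p v) e.
  apply: (@le_trans _ _ e%:E); last by rewrite leeDl// nneseries_ge0.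
  by rewrite -EFin_max lee_fin ge_max (ltW pe) ltW.
have [n nv] := dyadic_level_exists ep.
rewrite -[leLHS]add0e leeD ?lee_fin ?(ltW e0)//.
apply: (@le_trans _ _ (\sum_(0 <= i < n.+1) f i v)%E); last exact: nneseries_lim_ge.
rewrite big_nat_recr//= -[leLHS]add0e leeD ?sume_ge0//.
rewrite /f indicE mem_set// mule1 -EFin_max lee_fin ge_max e2 andbT.
by case/andP: nv => _ /ltW.
Qed.

End Dyadic.

Lemma zero_vec_norm1 (R : realType) (k : nat) (x : vec R k) :
  zero_vec x -> norm1 x = 0.
Proof. by move=> x0; apply: big1 => l _; rewrite x0 normr0. Qed.

(** * Incentive constraints and the gaps they give *)

Section Selection.
Context {R : realType} {k : nat}.
Variables (M : set (option_ R k)) (sel : vec R k -> option_ R k).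
Hypotheses (mechM : is_mechanism M) (selM : valid_selection M sel).

(** Individual rationality: the null option, of utility 0, is always available. *)
Lemma price_le_dot v : nonneg_vec v -> (sel v).2 <= dot v (sel v).1.
Proof.
move=> v0; have [_ [null [Mnull [null1 null2]]]] := mechM.
have [_ /(_ _ Mnull)] := selM v0.
rewrite /utility null2 subr0 [dot v null.1]big1 ?subr_ge0// => l _.
by rewrite null1 mulr0.
Qed.

Lemma price_le_norm1 v : nonneg_vec v -> (sel v).2 <= norm1 v.
Proof.
move=> v0; apply: le_trans (price_le_dot v0) _.
apply: ler_sum => l _; rewrite ger0_norm ?v0// ler_piMr ?v0//.
have [/mechM.1 /(_ l)] := selM v0.
by case/andP.
Qed.

(** Incentive compatibility: a buyer [v] does not prefer the option selected by [w]. *)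
Lemma price_diff_le v w : nonneg_vec v -> nonneg_vec w ->
  (sel v).2 - (sel w).2 <=
    \sum_(l < k) (tnth (sel v).1 l - tnth (sel w).1 l) * tnth v l.
Proof.
move=> v0 w0; have [_ /(_ _ (selM w0).1)] := selM v0.
rewrite /utility (_ : \sum_(l < k) _ = dot v (sel v).1 - dot v (sel w).1).
  lra.
by rewrite /dot -sumrB; apply: eq_bigr => l _; rewrite mulrC mulrBr.
Qed.

Section DyadicPrices.
Variables (e : R) (x : nat -> vec R k) (es : seq nat).
Hypothesis e0 : 0 < e.
Hypothesis es_spread : forall i j, (j < i < size es)%N ->
  (nth 0 es j + 2 <= nth 0 es i)%N.
Hypothesis x_ge0 : forall n, n \in es -> nonneg_vec (x n).
Hypothesis x_level : forall n, n \in es ->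
  e * 2 ^+ n <= (sel (x n)).2 < e * 2 ^+ n.+1.

Lemma gap_sum_ge_dyadic : gap_sum_ge (map x es)
  (\sum_(n <- es) e * 2 ^+ n / 2 / norm1 (x n)).
Proof.
pose z : vec R k := [tuple 0 | _ < k].
pose q n := (sel (x n)).1.
(* Index 0 must hold the zero allocation, so the selected allocations are shifted by one. *)
pose Q i := if i is i'.+1 then
  if (i' < size es)%N then q (nth 0%N es i') else z else z.
have Q01 i l : 0 <= tnth (Q i) l <= 1.
  case: i => [|i]; first by rewrite tnth_mktuple lexx ler01.
  rewrite /Q; case: ifP => [ies|_]; last by rewrite tnth_mktuple lexx ler01.
  have [/mechM.1/(_ l)] := selM (x_ge0 (mem_nth 0%N ies)).
  by [].
have gapQ i : (i < size es)%N ->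
    e * 2 ^+ nth 0%N es i / 2 <= gap (seq_points (map x es)) Q i.+1.
  move=> ies; have xi0 := x_ge0 (mem_nth 0%N ies).
  have /andP[pi _] := x_level (mem_nth 0%N ies).
  have e2 : 0 < e * 2 ^+ nth 0%N es i by rewrite mulr_gt0 ?exprn_gt0.
  apply/gap_geP => // j ji.
  rewrite /seq_points /= (nth_map 0%N)// ies.
  case: j ji => [_|j /= ji].
    (* Against the zero allocation the term is the value of the selected allocation, at least its
       price. *)
    apply: (@le_trans _ _ (dot (x (nth 0%N es i)) (q (nth 0%N es i)))).
      by apply: le_trans (price_le_dot xi0); lra.
    rewrite le_eqVlt; apply/orP; left; apply/eqP/eq_bigr => l _.
    by rewrite tnth_mktuple subr0 mulrC.
  have jes : (j < size es)%N by apply: ltn_trans ies.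
  rewrite jes; have xj0 := x_ge0 (mem_nth 0%N jes).
  have /andP[_ pj] := x_level (mem_nth 0%N jes).
  apply: le_trans (price_diff_le xi0 xj0).
  (* The exponents differ by at least 2, so the upper end of the earlier level is at most half the
     lower end of the later one. *)
  have : e * 2 ^+ (nth 0%N es j).+1 <= e * 2 ^+ nth 0%N es i / 2.
    rewrite -mulrA ler_pM2l// ler_pdivlMr// -exprSr ler_eXn2l ?ltr1n//.
    by have := @es_spread i j; rewrite addn2 => -> //; rewrite ies andbT.
  move: pi pj; lra.
exists Q; split.
- by split=> // l; rewrite tnth_mktuple.
- case=> // i; rewrite size_map /= => ies; apply: le_trans (gapQ _ ies).
  by rewrite !mulr_ge0 ?exprn_ge0// ltW.
rewrite size_map big_add1 /= (big_nth 0%N) big_nat_cond [leRHS]big_nat_cond.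
apply: ler_sum => i; rewrite andbT /= => ies.
rewrite {2}/seq_points /= (nth_map 0%N)//.
by rewrite ler_wpM2r ?invr_ge0 ?norm1_ge0// gapQ.
Qed.

End DyadicPrices.
End Selection.

(** * From the revenue of one mechanism to a finite gap sum *)

(** The constant is [9 = 2 * 2 * 2 * 9/8]: rounding prices up within a level, choosing a parity,
    halving the gap, and the norm bound cost one factor each. *)
Lemma exists_gap_sum_ge (R : realType) (k : nat) (D : probability (k.-tuple R) R)
    (M : set (option_ R k)) (sel : vec R k -> option_ R k) (c : R) :
  D [set v : k.-tuple R | nonneg_vec v] = 1%E ->
  (0 < BRev D)%E -> (BRev D < +oo)%E ->
  is_mechanism M -> valid_selection M sel ->
  measurable_fun setT (fun v : k.-tuple R => (sel v).2) ->
  ((9 * fine (BRev D) * c)%:E < \int[D]_v ((sel v).2)%:E)%E ->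
  exists s : seq (vec R k),
    (forall x, x \in s -> [/\ in_supp D x, nonneg_vec x & ~ zero_vec x]) /\
    gap_sum_ge s c.
Proof.
move=> D1 B0 Boo mechM selM msel cE.
set B := fine (BRev D) in cE *; have B0' : 0 < B by rewrite fine_gt0// B0.
(* The strict inequality leaves room for the loss of [e] and then for cutting the series at a finite
   [m]. *)
have [e e0 ceE] : exists2 e, 0 < e &
    ((9 * B * c)%:E + e%:E < \int[D]_v ((sel v).2)%:E)%E.
  case: (\int[D]_v _)%E cE => [r| |//].
    by rewrite lte_fin => h; exists ((r - 9 * B * c) / 2); rewrite -?EFinD ?lte_fin; lra.
  by move=> _; exists 1 => //; rewrite -EFinD ltry.
pose S n := @dyadic_level _ _ R (fun v : k.-tuple R => (sel v).2) e n.
have mS n : measurable (S n) by apply: measurable_dyadic_level.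
pose d n := fine (D (S n)).
have dE n : D (S n) = (d n)%:E by rewrite fineK// fin_num_measure.
have d_ge0 n : 0 <= d n by rewrite fine_ge0.
have [m Hm] : exists m, 9 * B * c < \sum_(0 <= n < m) e * 2 ^+ n.+1 * d n.
  have := lt_le_trans ceE (integral_le_dyadic D msel e0).
  rewrite addeC lteD2lE//.
  set u := (X in limn X).
  have u_nd : {homo u : n m / (n <= m)%N >-> (n <= m)%E}.
    apply: ereal_nondecreasing_series => n _ _.
    by rewrite mule_ge0// lee_fin mulr_ge0 ?exprn_ge0// ltW.
  rewrite (cvg_lim _ (ereal_nondecreasing_cvgn u_nd))//.
  move=> /ereal_sup_gt[_ [m _ <-]] h; exists m.
  rewrite -lte_fin -sumEFin; move: h; rewrite /u.
  by under eq_bigr do rewrite -/(S _) dE -EFinM.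
have [b Hb] : exists b, 9 / 2 * B * c <
    \sum_(0 <= n < m | odd n == b) e * 2 ^+ n.+1 * d n.
  apply: contrapT => h.
  have hle b : \sum_(0 <= n < m | odd n == b) e * 2 ^+ n.+1 * d n <= 9 / 2 * B * c.
    by rewrite leNgt; apply/negP => ?; apply: h; exists b.
  move: Hm; rewrite (bigID (fun n => odd n == true)) /=.
  rewrite [X in _ + X](eq_bigl (fun n => odd n == false)); last first.
    by move=> n; case: (odd n).
  by have := hle true; have := hle false; lra.
have /choice[x xP] : forall n, exists x, 0 < d n ->
    [/\ S n x, in_supp D x, nonneg_vec x & norm1 x * d n <= 9 / 8 * B].
  move=> n; have [dn|dn] := ltP 0 (d n); last first.
    by exists [tuple 0 | _ < k].
  have [|x xP] := exists_low_norm_supp D1 B0 Boo (mS n); first by rewrite dE.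
  by exists x.
pose es := [seq n <- index_iota 0 m | (odd n == b) && (0 < d n)].
have esP n : n \in es -> odd n = b /\ 0 < d n.
  by rewrite mem_filter => /andP[/andP[/eqP ? ?] _].
(* A positive price forces a positive norm, so the chosen points are nonzero. *)
have x_gt0 n : 0 < d n -> 0 < norm1 (x n).
  move=> dn; have [/andP[Sx _] _ xge0 _] := xP n dn.
  apply: lt_le_trans (price_le_norm1 mechM selM xge0).
  by apply: lt_le_trans Sx; rewrite mulr_gt0 ?exprn_gt0.
exists (map x es); split=> [_ /mapP[n /esP[_ dn] ->]|].
  have [_ ? ? _] := xP n dn; split=> // /zero_vec_norm1 h.
  by have := x_gt0 n dn; rewrite h ltxx.
have [|||Q [Q01 Qg Qs]] := @gap_sum_ge_dyadic R k M sel mechM selM e x es e0.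
- move=> i j /andP[ji ies].
  have jes := ltn_trans ji ies.
  have [oi _] := esP _ (mem_nth 0%N ies).
  have [oj _] := esP _ (mem_nth 0%N jes).
  have es_sorted : sorted ltn es.
    by apply: sorted_filter; [exact: ltn_trans|exact: iota_ltn_sorted].
  have : (nth 0 es j < nth 0 es i)%N.
    exact: (sorted_ltn_nth ltn_trans 0%N es_sorted).
  (* Equal parity excludes consecutive levels. *)
  rewrite leq_eqVlt addn2 => /predU1P[ij|//].
  by move: oi; rewrite -ij /= oj; case: (b).
- by move=> n /esP[_ dn]; have [] := xP n dn.
- by move=> n /esP[_ dn]; have [] := xP n dn.
exists Q; split=> //; apply: le_trans Qs.
rewrite big_filter -(@ler_pM2l _ (9 / 2 * B)) ?mulr_gt0//.
apply: ltW; apply: (lt_le_trans Hb); rewrite mulr_sumr.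
(* Levels of measure zero, left out of [es], contribute nothing. *)
rewrite (bigID (fun n => 0 < d n)) /= [X in _ + X]big1 ?addr0; last first.
  by move=> n /andP[_]; rewrite -leNgt => dn; rewrite (@le_anti _ _ (d n) 0) ?mulr0// dn d_ge0.
apply: ler_sum => n /andP[_ dn]; have [_ _ _ hx] := xP n dn.
have e2 : 0 < e * 2 ^+ n by rewrite mulr_gt0 ?exprn_gt0.
rewrite !mulrA ler_pdivlMr ?x_gt0// exprSr.
have : e * 2 ^+ n * (norm1 (x n) * d n) <= e * 2 ^+ n * (9 / 8 * B) by rewrite ler_pM2l.
lra.
Qed.

(** * Reaching the supremum with one sequence *)

Theorem theorem3p1 (R : realType) (k : nat) (D : probability (k.-tuple R) R) :
  D [set v : k.-tuple R | nonneg_vec v] = 1%E ->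
  (0 < BRev D)%E -> (BRev D < +oo)%E ->
  exists (N : seqlen) (X : nat -> vec R k),
    (forall i, in_range N i -> in_supp D (X i) /\ ~ zero_vec (X i)) /\
    (Rev D * ((9 * fine (BRev D))^-1)%:E <= MenuGap N X)%E.
Proof.
move=> D1 B0 Boo.
set B := fine (BRev D); have B0' : 0 < B by rewrite fine_gt0// B0.
have B9 : 0 < 9 * B by rewrite mulr_gt0.
pose z : vec R k := [tuple 0 | _ < k].
have [Rle0|R0] := leP (Rev D) 0%E.
  (* The empty sequence suffices, its series being 0. *)
  exists (Fin 0), (fun=> z); split; first by case.
  apply: (@le_trans _ _ 0%E).
    by rewrite mule_le0_ge0// lee_fin invr_ge0 ltW.
  apply: ereal_sup_ubound; exists (fun=> z); split.
    by split=> [l|_ l]; rewrite tnth_mktuple// lexx ler01.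
  rewrite (_ : (fun n => _) = cst 0%E); first exact: cvg_cst.
  apply/funext => n; rewrite /menugap_partial big1// => -[|i]//.
set T := (Rev D * _)%E.
have T0 : (0 < T)%E by rewrite mule_gt0// lte_fin invr_gt0.
have block (c : R) : 0 < c -> (c%:E < T)%E -> exists s : seq (vec R k),
    [/\ (0 < size s)%N,
     forall x, x \in s -> [/\ in_supp D x, nonneg_vec x & ~ zero_vec x] &
     gap_sum_ge s c].
  move=> c0; rewrite /T lte_pdivlMr// muleC => /ereal_sup_gt[_ [M [sel [mM vs ms ->]]]].
  rewrite -EFinM => /(exists_gap_sum_ge D1 B0 Boo mM vs ms)[s [sP sc]].
  (* A positive [c] rules out the empty sequence, whose gap sum is 0; concatenation needs nonempty
     blocks. *)
  exists s; split=> //; case: s sc {sP} => // -[Q [_ _]] /=.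
  by rewrite big_geq// leNgt c0.
have [c0 c00 c0T] : exists2 c0 : R, 0 < c0 & (c0%:E < T)%E.
  case: (T) T0 => [t| |//]; last by exists 1 => //; rewrite ltry.
  by rewrite lte_fin => t0; exists (t / 2); rewrite ?lte_fin; lra.
(* The targets [c m] run through all rationals in [(0, T)]; every other code gets the admissible
   default [c0]. *)
pose c m := if @unpickle rat m is Some q then
  if (0 < ratr q :> R) && ((ratr q)%:E < T)%E then ratr q else c0 else c0.
have /choice[s sP] : forall m, exists s : seq (vec R k),
    [/\ (0 < size s)%N,
     forall x, x \in s -> [/\ in_supp D x, nonneg_vec x & ~ zero_vec x] &
     gap_sum_ge s (c m)].
  move=> m; rewrite /c; case: unpickle => [q|]; last exact: block.
  by case: ifP => [/andP[]|_]; apply: block.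
have s_gt0 m : (0 < size (s m))%N by case: (sP m).
have s_ge0 m x : x \in s m -> nonneg_vec x by case: (sP m) => _ h _ /h[].
have MGc m : ((c m)%:E <= MenuGap Inf (concat_points s))%E.
  by have [_ _ sc] := sP m; apply: (MenuGap_concat s_gt0 s_ge0 sc).
exists Inf, (concat_points s); split=> [i|].
  rewrite /in_range andbT => /(concat_points_in s_gt0)[m].
  by case: (sP m) => _ h _ /h[].
rewrite -/T leNgt; apply/negP.
have c_gt0 m : 0 < c m.
  by rewrite /c; case: unpickle => // q; case: ifP => // /andP[].
case: (MenuGap _ _) MGc => [r| |] MGc; last 2 first.
- by rewrite ltNge leey.
- by have := MGc 0%N.
move=> rT.
have r0 : 0 < r by apply: lt_le_trans (c_gt0 0%N) _; rewrite -lee_fin.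
(* [T] may be infinite, so a real [y] with [r < y <= T] comes first; a rational between [r] and [y]
   is then some [c m], against [MGc]. *)
have [y ry yT] : exists2 y, r < y & (y%:E <= T)%E.
  case: (T) rT => [t| |//]; first by rewrite lte_fin => ?; exists t.
  by move=> _; exists (r + 1); rewrite ?leey//; lra.
have [q] := rat_in_itvoo ry; rewrite in_itv /= => /andP[rq qy].
have := MGc (pickle q); rewrite /c pickleK (lt_trans r0 rq) /=.
rewrite (lt_le_trans _ yT) ?lte_fin// lee_fin.
by rewrite leNgt rq.
Qed.
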